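(* Let $\lambda,\sigma,\tau>0$ be real and let $p,q,\eta_1,\eta_2$ be complex with $\Re(p)>0$, $\Re(q)>0$, $\Re(\eta_1)>0$ and $\Re(\eta_2)>0$. Then $$B_{p,q}^{\lambda;\sigma,\tau}(\eta_1,\eta_2)=\sum_{n=0}^\infty B_{p,q}^{\lambda;\sigma,\tau}(\eta_1+n,\eta_2+1).$$
   Context: $E_\lambda(x)=\sum_{n=0}^\infty \frac{x^n}{\Gamma(\lambda n+1)}$ is the Mittag-Leffler function. For real $\lambda,\sigma,\tau>0$ and complex $\eta_1,\eta_2,p,q$ with $\Re(\eta_1)>0$, $\Re(\eta_2)>0$, $\Re(p)\ge 0$, $\Re(q)\ge 0$, the extended beta function is $$B_{p,q}^{\lambda;\sigma,\tau}(\eta_1,\eta_2)=\int_0^1 t^{\eta_1-1}(1-t)^{\eta_2-1}E_\lambda\!\left(-\frac{p}{t^\sigma}\right)E_\lambda\!\left(-\frac{q}{(1-t)^\tau}\right)dt.$$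
   Formalization: The formal theorem adds the hypothesis that the integral defining B(η1,η2) converges (as an improper integral); it diverges for some allowed parameters, e.g. λ=4, σ=τ=1, p=q=1, η1=η2=1. Convergence of the integrals B(η1+n,η2+1) is proved. *)

(* Defs.v *)
From Stdlib Require Import Reals.
From Coquelicot Require Import Coquelicot.
Open Scope R_scope.

(* Euler's integral, convergent for [0 < x]. *)
Definition Gamma (x : R) : R :=
  RInt_gen (fun t : R => Rpower t (x - 1) * exp (- t))
    (at_right 0) (Rbar_locally p_infty).

(* [Series] is real-valued, so the complex series is summed componentwise. *)
Definition mittag_leffler (lambda : R) (z : C) : C :=
  (Series (fun n : nat => Re (Cpow z n / RtoC (Gamma (lambda * INR n + 1)%R))%C),
   Series (fun n : nat => Im (Cpow z n / RtoC (Gamma (lambda * INR n + 1)%R))%C)).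

(* Principal value of [t ^ z = exp (z * ln t)], meaningful for [0 < t]. *)
Definition Rcpower (t : R) (z : C) : C :=
  (exp (Re z * ln t) * cos (Im z * ln t),
   exp (Re z * ln t) * sin (Im z * ln t)).

Definition ext_beta_integrand (lambda sigma tau : R) (p q eta1 eta2 : C) (t : R) : C :=
  (Rcpower t (eta1 - 1) * Rcpower (1 - t) (eta2 - 1)
   * mittag_leffler lambda (- p / RtoC (Rpower t sigma))
   * mittag_leffler lambda (- q / RtoC (Rpower (1 - t) tau)))%C.

(* The integrand may be singular at both endpoints, so the integral over (0, 1)
   is the improper one: the limit of the integrals over [a, b] as a -> 0+ and
   b -> 1-.  It need not exist: for [z > 0], the Mittag-Leffler
   function with [lambda = 4] takes at [- z] the value [cos y * cosh y] with
   [y = z^(1/4) / sqrt 2], so for [p, q > 0] the integrand then oscillates with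
   exponentially growing amplitude at the endpoints. *)
Definition ext_beta_converges (lambda sigma tau : R) (p q eta1 eta2 : C) : Prop :=
  ex_RInt_gen (V := C_R_NormedModule)
    (ext_beta_integrand lambda sigma tau p q eta1 eta2) (at_right 0) (at_left 1).

(* Total function; it is the integral only under [ext_beta_converges]. *)
Definition ext_beta (lambda sigma tau : R) (p q eta1 eta2 : C) : C :=
  RInt_gen (V := C_R_CompleteNormedModule)
    (ext_beta_integrand lambda sigma tau p q eta1 eta2) (at_right 0) (at_left 1).

(* Main.v *)
Require Import Defs.
From Stdlib Require Import Reals Lra Lia.
From Coquelicot Require Import Coquelicot.
Open Scope R_scope.

(** Write [f] for the integrand of the left-hand side.  On (0, 1), raising
    [eta1] by [n] and [eta2] by 1 multiplies [f t] by [t ^ n * (1 - t)], and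
    these weights telescope: their sum up to [N] is [1 - t ^ (N + 1)].  The
    identity therefore says that the moments [M m], the integrals of
    [f t * t ^ m] over (0, 1), exist and tend to 0: the [n]-th term of the series
    is [M n - M (n + 1)], and its sum is [M 0].

    The hypothesis is convergence of an improper integral, not absolute
    convergence, so the limit is taken by Abel's method rather than by dominated
    convergence.  A convergent improper integral has a primitive [Phi] that
    extends continuously to the closed interval ([primitive_of_RInt_gen]).
    Integration by parts ([primitive_on_mult]) turns the [m]-th moment, for [m > 0], into

      [Phi 1 - int_0^1 Phi t * (m * t ^ (m - 1)) dt],

    an integral of a continuous function; this gives the existence of the
    moments.  The densities [m * t ^ (m - 1)] have mass 1 and concentrate at 1,
    hence the integral tends to [Phi 1] ([is_lim_seq_power_average]) and the
    moments tend to 0 ([moments_vanish]).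

    The regularity of [f] comes from its convergent integral alone: [f] is Riemann
    integrable on the compact subintervals of (0, 1).  Thus [Phi] need not be
    differentiable, and the product rule cannot give the integration by parts;
    [is_RInt_mult_by_parts] obtains it by freezing [g] on the cells of a fine
    mesh. *)

(** * Integration by parts against a Riemann integrable function *)

(** Stability of the integral under uniform limits, in a form where the value of
    the limit is known in advance: it yields integrability and value at once. *)
Lemma is_RInt_of_approx (f : R -> R) (a b I : R) :
  a <= b ->
  (forall eps : posreal, exists (h : R -> R) (J : R),
     is_RInt h a b J /\
     (forall t, a <= t <= b -> Rabs (f t - h t) <= eps) /\
     Rabs (J - I) <= eps) ->
  is_RInt f a b I.
Proof.
  intros hab H.
  apply filterlim_locally; intros eps.
  (* Riemann sums of [f] and [h] differ by at most [e * (b - a)], and two more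
     errors [e] occur: those of [h] and of [J]. *)
  assert (he : 0 < eps / (2 * (b - a + 2))).
  { apply Rdiv_lt_0_compat; [apply cond_pos | lra]. }
  destruct (H (mkposreal _ he)) as [h [J [Hh [Hfh HJ]]]].
  cbn in Hfh, HJ. set (e := eps / (2 * (b - a + 2))) in *.
  assert (hee : e * (b - a) + 2 * e = eps / 2) by (unfold e; field; lra).
  generalize (proj1 (filterlim_locally _ _) Hh (mkposreal _ he)).
  unfold Riemann_fine, within. apply filter_imp.
  intros ptd Hb [Hp [Ha0 Hb0]]. specialize (Hb (conj Hp (conj Ha0 Hb0))).
  rewrite (Rmin_left _ _ hab) in Ha0. rewrite (Rmax_right _ _ hab) in Hb0.
  cbn in Hb. unfold AbsRing_ball, abs, minus, plus, opp, scal in Hb; cbn in Hb.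
  cbn. unfold AbsRing_ball, abs, minus, plus, opp, scal; cbn.
  unfold mult in *; cbn in *.
  assert (Hd : Rabs (Riemann_sum f ptd - Riemann_sum h ptd) <= e * (b - a)).
  { generalize (Riemann_sum_norm (fun t => minus (f t) (h t)) (fun _ => e) ptd Hp).
    rewrite (Riemann_sum_minus (V := R_ModuleSpace)), Riemann_sum_const.
    change (seq.last (SF_h ptd) (SF_lx ptd) = b) in Hb0.
    rewrite Hb0, Ha0.
    unfold scal; cbn; unfold mult; cbn. rewrite (Rmult_comm (b - a)).
    intros K; apply K; exact Hfh. }
  assert (Hs : Rabs (sign (b - a)) <= 1).
  { destruct (Rle_lt_or_eq_dec _ _ hab) as [hlt | heq].
    - rewrite sign_eq_1 by lra. rewrite Rabs_R1; lra.
    - replace (b - a) with 0 by lra. rewrite sign_0, Rabs_R0; lra. }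
  set (s := sign (b - a)) in *. set (F := Riemann_sum f ptd) in *.
  set (G := Riemann_sum h ptd) in *.
  change (Rabs (s * F - I) < eps). change (Rabs (s * G - J) < e) in Hb.
  replace (s * F - I) with (s * (F - G) + ((s * G - J) + (J - I))) by ring.
  assert (Rabs (s * (F - G)) <= 1 * (e * (b - a))).
  { rewrite Rabs_mult. apply Rmult_le_compat; auto using Rabs_pos. }
  assert (T1 := Rabs_triang (s * (F - G)) ((s * G - J) + (J - I))).
  assert (T2 := Rabs_triang (s * G - J) (J - I)).
  generalize (cond_pos eps); lra.
Qed.

Lemma ex_RInt_continuous_all (f : R -> R) (a b : R) :
  (forall x, continuous f x) -> ex_RInt f a b.
Proof. intros H; apply (ex_RInt_continuous (V := R_CompleteNormedModule)); auto. Qed.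

(** The integral of [f * g] between [x] and [y], expressed with a primitive [Phi]
    of [f] and the derivative [dg] of [g]. *)
Definition by_parts_value (Phi g dg : R -> R) (x y : R) : R :=
  Phi y * g y - Phi x * g x - RInt (fun t => Phi t * dg t) x y.

Section ByParts.
Variables (f Phi g dg : R -> R) (a b : R).
Hypothesis hPhi : forall x, continuous Phi x.
Hypothesis hf : forall x y, a <= x <= b -> a <= y <= b -> is_RInt f x y (Phi y - Phi x).
Hypothesis hg : forall x, is_derive g x (dg x).
Hypothesis hdg : forall x, continuous dg x.

Let T := by_parts_value Phi g dg.

Lemma ex_RInt_primitive_mult x y : ex_RInt (fun t => Phi t * dg t) x y.
Proof.
  apply ex_RInt_continuous_all; intros z.
  apply (continuous_mult (K := R_AbsRing)); auto.
Qed.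

Lemma by_parts_value_Chasles x y z : T x y + T y z = T x z.
Proof.
  unfold T, by_parts_value.
  rewrite <- (RInt_Chasles _ x y z
    (ex_RInt_primitive_mult _ _) (ex_RInt_primitive_mult _ _)).
  unfold plus; cbn; ring.
Qed.

(** Freezing [g] at [x] makes the integral of [f * g] equal to
    [g x * (Phi y - Phi x)].  The error is an integral in which [Phi t - Phi y]
    is small, hence [o(y - x)]: errors over a fine mesh add up to little. *)
Lemma by_parts_defect x y :
  is_RInt (fun t => (Phi t - Phi y) * dg t) x y (g x * (Phi y - Phi x) - T x y).
Proof.
  assert (Hdg : is_RInt dg x y (minus (g y) (g x))).
  { apply (is_RInt_derive (V := R_CompleteNormedModule)); auto. }
  assert (H := is_RInt_minus _ _ _ _ _ _
    (RInt_correct _ _ _ (ex_RInt_primitive_mult x y)) (is_RInt_scal _ _ _ (Phi y) _ Hdg)).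
  replace (g x * (Phi y - Phi x) - T x y)
    with (minus (RInt (fun t => Phi t * dg t) x y) (scal (Phi y) (minus (g y) (g x)))).
  - revert H; apply is_RInt_ext; intros t _.
    unfold minus, plus, opp, scal; cbn; unfold mult; cbn; ring.
  - unfold T, by_parts_value, minus, plus, opp, scal; cbn; unfold mult; cbn; ring.
Qed.

Lemma freeze_on_short_interval (eps : posreal) : a <= b ->
  exists delta : posreal, forall x y, a <= x -> x <= y -> y <= b -> y - x < delta ->
    (forall t, x <= t <= y -> Rabs (f t * g t - f t * g x) <= eps) /\
    Rabs (g x * (Phi y - Phi x) - T x y) <= eps * (y - x).
Proof.
  intros hab.
  assert (hgc : forall x, continuous g x).
  { intros x; apply (ex_derive_continuous (K := R_AbsRing) (V := R_NormedModule)).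
    exists (dg x); apply hg. }
  destruct (ex_RInt_ub f a b) as [M HM].
  { exists (Phi b - Phi a); apply hf; lra. }
  destruct (ex_RInt_ub dg a b) as [K HK].
  { apply ex_RInt_continuous_all, hdg. }
  rewrite Rmin_left, Rmax_right in HM, HK by exact hab.
  assert (HM0 : 0 <= M) by (apply Rle_trans with (2 := HM a ltac:(lra)); apply norm_ge_0).
  assert (HK0 : 0 <= K) by (apply Rle_trans with (2 := HK a ltac:(lra)); apply norm_ge_0).
  assert (h1 : 0 < eps / (M + 1)) by (apply Rdiv_lt_0_compat; [apply cond_pos | lra]).
  assert (h2 : 0 < eps / (K + 1)) by (apply Rdiv_lt_0_compat; [apply cond_pos | lra]).
  destruct (unifcont_normed_1d g a b (fun x _ => hgc x) (mkposreal _ h1)) as [d1 H1].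
  destruct (unifcont_normed_1d Phi a b (fun x _ => hPhi x) (mkposreal _ h2)) as [d2 H2].
  assert (hd : 0 < Rmin d1 d2) by (apply Rmin_pos; apply cond_pos).
  exists (mkposreal _ hd); cbn; intros x y hx hxy hy hd12.
  assert (hd1 := Rmin_l d1 d2). assert (hd2 := Rmin_r d1 d2).
  assert (B : forall u v, x <= u <= y -> x <= v <= y -> Rabs (v - u) < Rmin d1 d2).
  { intros u v hu hv. apply Rle_lt_trans with (2 := hd12). apply Rabs_le; lra. }
  split.
  - intros t ht.
    assert (Hb := H1 x t ltac:(lra) ltac:(lra)).
    unfold ball, ball_norm in Hb; cbn in Hb.
    unfold AbsRing_ball, norm, abs, minus, plus, opp in Hb; cbn in Hb.
    assert (Hg := Hb ltac:(apply Rlt_le_trans with (2 := hd1); apply B; lra)).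
    replace (f t * g t - f t * g x) with (f t * (g t + - g x)) by ring.
    rewrite Rabs_mult.
    apply Rle_trans with (M * (eps / (M + 1))).
    + apply Rmult_le_compat; try apply Rabs_pos; [apply HM; lra | lra].
    + replace (M * (eps / (M + 1))) with (eps - eps / (M + 1)) by (field; lra). lra.
  - rewrite (Rmult_comm eps).
    apply (norm_RInt_le_const _ _ _ _ eps hxy) with (2 := by_parts_defect x y).
    intros t ht.
    assert (Hb := H2 y t ltac:(lra) ltac:(lra)).
    unfold ball, ball_norm in Hb; cbn in Hb.
    unfold AbsRing_ball, norm, abs, minus, plus, opp in Hb; cbn in Hb.
    assert (Hg := Hb ltac:(apply Rlt_le_trans with (2 := hd2); apply B; lra)).
    unfold norm; cbn; unfold abs; cbn. rewrite Rabs_mult, Rmult_comm.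
    apply Rle_trans with (K * (eps / (K + 1))).
    + apply Rmult_le_compat; try apply Rabs_pos; [apply HK; lra | unfold Rminus; lra].
    + replace (K * (eps / (K + 1))) with (eps - eps / (K + 1)) by (field; lra). lra.
Qed.

(** The error on the value is proportional to the length, which makes the
    property additive over adjacent intervals. *)
Definition approximable (eps x y : R) := exists (h : R -> R) (J : R),
     is_RInt h x y J /\
     (forall t, x <= t <= y -> Rabs (f t * g t - h t) <= eps) /\
     Rabs (J - T x y) <= eps * (y - x).

Lemma approximable_glue eps x y z : x <= y -> y <= z ->
  approximable eps x y -> approximable eps y z -> approximable eps x z.
Proof.
  intros hxy hyz [h1 [J1 [I1 [F1 A1]]]] [h2 [J2 [I2 [F2 A2]]]].
  exists (fun t => if Rle_dec t y then h1 t else h2 t), (J1 + J2).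
  split; [| split].
  - apply (is_RInt_Chasles _ x y z J1 J2).
    + revert I1; apply is_RInt_ext; intros t ht.
      rewrite Rmin_left, Rmax_right in ht by lra.
      destruct (Rle_dec t y); [reflexivity | lra].
    + revert I2; apply is_RInt_ext; intros t ht.
      rewrite Rmin_left, Rmax_right in ht by lra.
      destruct (Rle_dec t y); [lra | reflexivity].
  - intros t ht. destruct (Rle_dec t y); [apply F1 | apply F2]; lra.
  - rewrite <- (by_parts_value_Chasles x y z).
    replace (J1 + J2 - (T x y + T y z)) with ((J1 - T x y) + (J2 - T y z)) by ring.
    eapply Rle_trans; [apply Rabs_triang | lra].
Qed.

Lemma approximable_segment (eps : posreal) : a <= b -> approximable eps a b.
Proof.
  intros hab. destruct (freeze_on_short_interval eps hab) as [d Hd].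
  assert (hd := cond_pos d).
  assert (short : forall x y, a <= x -> x <= y -> y <= b -> y - x < d -> approximable eps x y).
  { intros x y hx hxy hy hs. destruct (Hd x y hx hxy hy hs) as [H1 H2].
    exists (fun t => f t * g x), (g x * (Phi y - Phi x)).
    split; [| split]; try assumption.
    generalize (is_RInt_scal _ _ _ (g x) _ (hf x y ltac:(lra) ltac:(lra))).
    apply is_RInt_ext; intros t _. unfold scal; cbn; unfold mult; cbn; ring. }
  (* March to the right by steps of half the admissible length. *)
  assert (long : forall n x, a <= x -> x <= b -> b - x < INR n * (d / 2) -> approximable eps x b).
  { induction n as [| n IH]; intros x hx hxb hn.
    - cbn in hn; lra.
    - rewrite S_INR in hn.
      destruct (Rlt_dec (b - x) d) as [hs | hl].
      + apply short; lra.
      + apply approximable_glue with (x + d / 2); try lra.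
        * apply short; lra.
        * apply IH; lra. }
  destruct (INR_unbounded ((b - a) / (d / 2))) as [n hn].
  apply (long n); try lra.
  apply Rmult_lt_compat_r with (r := d / 2) in hn; [| lra].
  replace ((b - a) / (d / 2) * (d / 2)) with (b - a) in hn by (field; lra). lra.
Qed.

(** On a fine mesh, [f * g] is uniformly close to a function that is a constant
    multiple of [f] on each cell, hence is integrable with a known integral. *)
Lemma is_RInt_mult_by_parts : a <= b ->
  is_RInt (fun t => f t * g t) a b (T a b).
Proof.
  intros hab. apply is_RInt_of_approx; [exact hab |]. intros eps.
  (* The 1 in the denominator allows [a = b]. *)
  assert (he : 0 < eps / (b - a + 1)) by (apply Rdiv_lt_0_compat; [apply cond_pos | lra]).
  assert (E : eps / (b - a + 1) * (b - a) = eps - eps / (b - a + 1)) by (field; lra).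
  assert (E2 : eps / (b - a + 1) <= eps).
  { enough (0 <= eps / (b - a + 1) * (b - a)) by lra. apply Rmult_le_pos; lra. }
  destruct (approximable_segment (mkposreal _ he) hab) as [h [J [H1 [H2 H3]]]]; cbn in *.
  exists h, J. split; [| split]; [exact H1 | |].
  - intros t ht; specialize (H2 t ht); lra.
  - lra.
Qed.
End ByParts.

(** * Improper integrals and continuous primitives *)

(** Continuity is required on the whole line, in particular at [a] and [b]:
    this is what encodes the convergence of the integral of [f] at both ends. *)
Definition primitive_on (a b : R) (f Phi : R -> R) : Prop :=
  (forall x, continuous Phi x) /\
  (forall x y, a < x < b -> a < y < b -> is_RInt f x y (Phi y - Phi x)).

Lemma filter_prod_near_endpoints (a b u v : R) : a < u -> v < b ->
  filter_prod (at_right a) (at_left b) (fun z => a < fst z < u /\ v < snd z < b).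
Proof.
  intros hu hv. apply (Filter_prod _ _ _ (fun x => a < x < u) (fun y => v < y < b)).
  - apply filter_and.
    + exists (mkposreal 1 Rlt_0_1). intros z _ hz; exact hz.
    + apply filter_le_within. apply (open_lt u a hu).
  - apply filter_and.
    + apply filter_le_within. apply (open_gt v b hv).
    + exists (mkposreal 1 Rlt_0_1). intros z _ hz; exact hz.
  - cbn; auto.
Qed.

Lemma is_RInt_gen_primitive (a b : R) (f Phi : R -> R) :
  a < b -> primitive_on a b f Phi ->
  is_RInt_gen f (at_right a) (at_left b) (Phi b - Phi a).
Proof.
  intros hab [hc hf].
  apply (filterlimi_lim_ext_loc (fun z : R * R => Phi (snd z) - Phi (fst z))).
  - generalize (filter_prod_near_endpoints a b b a hab hab). apply filter_imp.
    intros z [h1 h2]; apply hf; assumption.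
  - apply (filterlim_comp_2 (fun z : R * R => Phi (snd z)) (fun z => - Phi (fst z)) Rplus
             (G := locally (Phi b)) (H := locally (- Phi a))).
    + apply filterlim_comp with (2 := hc b).
      apply filterlim_filter_le_2 with (2 := filterlim_snd). apply filter_le_within.
    + apply filterlim_comp with (2 := filterlim_opp (V := R_NormedModule) (Phi a)).
      apply filterlim_comp with (2 := hc a).
      apply filterlim_filter_le_2 with (2 := filterlim_fst). apply filter_le_within.
    + apply (filterlim_plus (V := R_NormedModule) (Phi b) (- Phi a)).
Qed.

Lemma ex_RInt_of_RInt_gen (a b : R) (f : R -> R) (x y : R) :
  ex_RInt_gen f (at_right a) (at_left b) ->
  a < x < b -> a < y < b -> ex_RInt f x y.
Proof.
  intros [I HI] hx hy.
  assert (hu : a < Rmin x y) by (apply Rmin_glb_lt; lra).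
  assert (hv : Rmax x y < b) by (apply Rmax_lub_lt; lra).
  assert (H := filter_and _ _
    (proj1 (filterlimi_locally _ _) HI (mkposreal 1 Rlt_0_1))
    (filter_prod_near_endpoints a b (Rmin x y) (Rmax x y) hu hv)).
  destruct (filter_ex _ H) as [[u v] [[J [HJ _]] [hu' hv']]].
  cbn [fst snd] in HJ, hu', hv'.
  assert (h1 := Rmin_l x y). assert (h2 := Rmin_r x y).
  assert (h3 := Rmax_l x y). assert (h4 := Rmax_r x y).
  assert (E : forall w, Rmin x y <= w <= Rmax x y -> ex_RInt f u w).
  { intros w hw. apply (ex_RInt_Chasles_1 (V := R_CompleteNormedModule)) with v; [lra |].
    exists J; exact HJ. }
  apply ex_RInt_Chasles with u; [apply ex_RInt_swap |]; apply E; lra.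
Qed.

(** The primitive from an interior point is Cauchy at each endpoint: fix one
    bound of integration and move the other.  Hence it extends continuously. *)
Lemma primitive_of_RInt_gen (a b : R) (f : R -> R) (I : R) :
  a < b -> is_RInt_gen f (at_right a) (at_left b) I ->
  exists Phi, primitive_on a b f Phi /\ Phi b - Phi a = I.
Proof.
  intros hab HI.
  set (c := (a + b) / 2). assert (hc : a < c < b) by (unfold c; lra).
  set (F := (fun x => RInt f c x) : R -> R).
  assert (Hex : forall x y, a < x < b -> a < y < b -> ex_RInt f x y).
  { intros x y; apply ex_RInt_of_RInt_gen. exists I; exact HI. }
  assert (HF : forall x y, a < x < b -> a < y < b -> is_RInt f x y (F y - F x)).
  { intros x y hx hy. replace (F y - F x) with (RInt f x y).
    - apply (RInt_correct (V := R_CompleteNormedModule)); auto.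
    - unfold F. rewrite <- (RInt_Chasles f c x y) by auto. unfold plus; cbn; ring. }
  assert (Hcauchy : forall eps : posreal, exists P Q : R -> Prop,
    at_right a P /\ at_left b Q /\ (exists x, P x) /\ (exists y, Q y) /\
    forall x y, P x -> Q y -> Rabs (F y - F x - I) < eps).
  { intros eps. apply filterlimi_locally with (eps := eps) in HI.
    assert (HI' := filter_and _ _ HI (filter_prod_near_endpoints a b b a hab hab)).
    destruct HI' as [P Q hP hQ H]. exists P, Q.
    split; [exact hP | split; [exact hQ |]].
    split; [exact (filter_ex _ hP) | split; [exact (filter_ex _ hQ) |]].
    intros x y Px Qy. destruct (H x y Px Qy) as [[J [HJ Hb]] [hx hy]]. cbn in HJ, hx, hy.
    assert (HJ2 := is_RInt_unique _ _ _ _ HJ).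
    rewrite (is_RInt_unique _ _ _ _ (HF x y hx hy)) in HJ2. rewrite HJ2. exact Hb. }
  assert (Hla : exists la, filterlim F (at_right a) (locally la)).
  { apply (filterlim_locally_cauchy (U := R_CompleteSpace)). intros eps.
    assert (he : 0 < eps / 2) by (generalize (cond_pos eps); lra).
    destruct (Hcauchy (mkposreal _ he)) as [P [Q [hP [hQ [_ [[y Qy] H]]]]]]; cbn [pos] in H.
    exists P; split; [exact hP |]. intros u v Pu Pv.
    assert (h1 := H u y Pu Qy). assert (h2 := H v y Pv Qy).
    change (Rabs (F v - F u) < eps).
    apply Rabs_def2 in h1. apply Rabs_def2 in h2. apply Rabs_def1; lra. }
  assert (Hlb : exists lb, filterlim F (at_left b) (locally lb)).
  { apply (filterlim_locally_cauchy (U := R_CompleteSpace)). intros eps.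
    assert (he : 0 < eps / 2) by (generalize (cond_pos eps); lra).
    destruct (Hcauchy (mkposreal _ he)) as [P [Q [hP [hQ [[x Px] [_ H]]]]]]; cbn [pos] in H.
    exists Q; split; [exact hQ |]. intros u v Qu Qv.
    assert (h1 := H x u Px Qu). assert (h2 := H x v Px Qv).
    change (Rabs (F v - F u) < eps).
    apply Rabs_def2 in h1. apply Rabs_def2 in h2. apply Rabs_def1; lra. }
  destruct Hla as [la Hla]. destruct Hlb as [lb Hlb].
  destruct (C0_extension_lt (T := R_UniformSpace) F la lb a b hab) as [Phi [H1 [H2 _]]];
    [| exact Hla | exact Hlb |].
  { intros x hx. apply (continuous_RInt_1 f c x F).
    generalize (locally_interval (fun z => a < z < b) x a b (proj1 hx) (proj2 hx)
      (fun y h1 h2 => conj h1 h2)).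
    apply filter_imp. intros z hz.
    apply (RInt_correct (V := R_CompleteNormedModule)); auto. }
  assert (HPhi : primitive_on a b f Phi).
  { split; [exact H1 |]. intros x y hx hy.
    rewrite (H2 x hx), (H2 y hy). auto. }
  exists Phi; split; [exact HPhi |].
  rewrite <- (is_RInt_gen_unique _ _ HI). symmetry.
  apply is_RInt_gen_unique. apply is_RInt_gen_primitive; assumption.
Qed.

(** A form of Dirichlet's test: the primitive that integration by parts yields is
    continuous up to the endpoints because [Phi] is, so a [C^1] factor preserves
    conditional convergence. *)
Lemma primitive_on_mult (a b : R) (f Phi g dg : R -> R) :
  primitive_on a b f Phi ->
  (forall x, is_derive g x (dg x)) -> (forall x, continuous dg x) ->
  primitive_on a b (fun t => f t * g t)
    (fun x => Phi x * g x - RInt (fun t => Phi t * dg t) a x).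
Proof.
  intros [hc hf] hg hdg. split.
  - intros x.
    assert (hgc : continuous g x).
    { apply (ex_derive_continuous (K := R_AbsRing) (V := R_NormedModule)).
      exists (dg x); apply hg. }
    apply (continuous_minus (V := R_NormedModule)).
    + apply (continuous_mult (K := R_AbsRing)); auto.
    + apply (continuous_RInt_1 (fun t => Phi t * dg t) a x).
      apply filter_forall. intros z. apply (RInt_correct (V := R_CompleteNormedModule)).
      apply (ex_RInt_primitive_mult Phi dg); assumption.
  - assert (Hle : forall x y, a < x < b -> a < y < b -> x <= y ->
      is_RInt (fun t => f t * g t) x y
       (Phi y * g y - RInt (fun t => Phi t * dg t) a y
         - (Phi x * g x - RInt (fun t => Phi t * dg t) a x))).
    { intros x y hx hy hxy.
      assert (H := is_RInt_mult_by_parts f Phi g dg x y hc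
        ltac:(intros u v hu hv; apply hf; lra) hg hdg hxy).
      assert (Ch := RInt_Chasles _ a x y
        (ex_RInt_primitive_mult Phi dg hc hdg a x) (ex_RInt_primitive_mult Phi dg hc hdg x y)).
      rewrite <- Ch. revert H. unfold by_parts_value, plus; cbn.
      match goal with |- is_RInt _ _ _ ?u -> is_RInt _ _ _ ?v => replace v with u by ring end.
      auto. }
    intros x y hx hy. destruct (Rle_dec x y) as [hxy | hxy].
    + apply Hle; auto.
    + assert (H := is_RInt_swap _ _ _ _ (Hle y x hy hx ltac:(lra))). revert H.
      unfold opp; cbn.
      match goal with |- is_RInt _ _ _ ?u -> is_RInt _ _ _ ?v => replace v with u by ring end.
      auto.
Qed.

(** * Moments of a conditionally convergent integral *)

Lemma is_derive_pow_S (m : nat) (t : R) :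
  is_derive (fun t => t ^ S m) t (INR (S m) * t ^ m).
Proof.
  rewrite <- (Rmult_1_r (INR (S m))).
  apply (is_derive_pow (fun t => t) (S m) t 1), (is_derive_id (K := R_AbsRing)).
Qed.

Lemma continuous_power_density (m : nat) (t : R) :
  continuous (fun t => INR (S m) * t ^ m) t.
Proof.
  apply (ex_derive_continuous (K := R_AbsRing) (V := R_NormedModule)).
  auto_derive; exact I.
Qed.

Lemma is_RInt_power_density (m : nat) :
  is_RInt (fun t => INR (S m) * t ^ m) 0 1 1.
Proof.
  replace 1 with (minus (1 ^ S m) (0 ^ S m)) at 2.
  - apply (is_RInt_derive (V := R_CompleteNormedModule) (fun t => t ^ S m)).
    + intros t _. apply is_derive_pow_S.
    + intros t _. apply continuous_power_density.
  - rewrite pow1, pow_i by lia. unfold minus, plus, opp; cbn; ring.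
Qed.

Lemma is_RInt_power_density_gap (m : nat) :
  is_RInt (fun t => INR (S m) * t ^ m * (1 - t)) 0 1 (/ INR (S (S m))).
Proof.
  assert (h : INR (S (S m)) <> 0) by (apply not_0_INR; lia).
  replace (/ INR (S (S m))) with (1 - INR (S m) / INR (S (S m)) * 1).
  2:{ rewrite (S_INR (S m)) in *. field. exact h. }
  assert (H := is_RInt_minus _ _ _ _ _ _ (is_RInt_power_density m)
    (is_RInt_scal _ _ _ (INR (S m) / INR (S (S m))) _ (is_RInt_power_density (S m)))).
  revert H. apply is_RInt_ext. intros t _.
  unfold minus, plus, opp, scal; cbn -[INR]; unfold mult; cbn -[INR].
  field. exact h.
Qed.

(** Near 1 the [eps] is enough; away from 1 the slope [C] absorbs the maximum.  An
    affine bound is chosen because it can be integrated in closed form against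
    powers of [t] over the whole of [0, 1]. *)
Lemma oscillation_bound (Phi : R -> R) (eps : R) :
  (forall x, continuous Phi x) -> 0 < eps ->
  exists C, 0 <= C /\ forall t, 0 <= t <= 1 -> Rabs (Phi t - Phi 1) <= eps + C * (1 - t).
Proof.
  intros hc he.
  destruct (ex_RInt_ub (fun t => Phi t - Phi 1) 0 1) as [B HB].
  { apply ex_RInt_continuous_all. intros x.
    apply (continuous_minus (V := R_NormedModule)); [apply hc | apply continuous_const]. }
  rewrite Rmin_left, Rmax_right in HB by lra.
  destruct (proj1 (filterlim_locally _ _) (hc 1) (mkposreal _ he)) as [d Hd].
  assert (hd := cond_pos d).
  assert (HB0 : 0 <= B) by (apply Rle_trans with (2 := HB 0 ltac:(lra)); apply norm_ge_0).
  assert (HBd : 0 <= B / d) by (apply Rdiv_le_0_compat; assumption).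
  exists (B / d). split; [exact HBd |]. intros t ht.
  destruct (Rlt_dec (1 - t) d) as [h | h].
  - assert (H : Rabs (Phi t - Phi 1) < eps).
    { apply (Hd t). change (Rabs (t - 1) < d). rewrite Rabs_left1; lra. }
    assert (0 <= B / d * (1 - t)) by (apply Rmult_le_pos; lra). lra.
  - apply Rle_trans with B; [apply (HB t ht) |].
    replace B with (B / d * d) at 1 by (field; lra).
    assert (B / d * d <= B / d * (1 - t)) by (apply Rmult_le_compat_l; lra). lra.
Qed.

(** The densities [(m + 1) * t ^ m] have mass 1, and the mean of [1 - t] under
    them is [1 / (m + 2)]; integrate [oscillation_bound]. *)
Lemma is_lim_seq_power_average (Phi : R -> R) :
  (forall x, continuous Phi x) ->
  is_lim_seq (fun m => RInt (fun t => Phi t * (INR (S m) * t ^ m)) 0 1) (Phi 1).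
Proof.
  intros hc. apply is_lim_seq_spec. intros eps.
  assert (he : 0 < eps / 2) by (generalize (cond_pos eps); lra).
  destruct (oscillation_bound Phi (eps / 2) hc he) as [C [hC HC]].
  destruct (INR_unbounded (C / (eps / 2))) as [N HN].
  exists N. intros m hm.
  set (W := RInt _ 0 1 : R).
  assert (HW : is_RInt (fun t => Phi t * (INR (S m) * t ^ m)) 0 1 W).
  { apply (RInt_correct (V := R_CompleteNormedModule)).
    apply ex_RInt_continuous_all. intros x.
    apply (continuous_mult (K := R_AbsRing)); [apply hc |].
    apply continuous_power_density. }
  assert (hm0 : 0 < INR (S m)) by (apply lt_0_INR; lia).
  assert (hm1 : 0 < INR (S (S m))) by (apply lt_0_INR; lia).
  assert (H1 := is_RInt_minus _ _ _ _ _ _ HW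
    (is_RInt_scal _ _ _ (Phi 1) _ (is_RInt_power_density m))).
  assert (H2 := is_RInt_plus _ _ _ _ _ _
    (is_RInt_scal _ _ _ (eps / 2) _ (is_RInt_power_density m))
    (is_RInt_scal _ _ _ C _ (is_RInt_power_density_gap m))).
  assert (H : Rabs (W - Phi 1) <= eps / 2 + C / INR (S (S m))).
  { apply Rle_trans with (norm (minus W (scal (Phi 1) 1))).
    { right. unfold norm, minus, plus, opp, scal; cbn -[W]; unfold abs, mult; cbn -[W].
      f_equal; ring. }
    apply Rle_trans with (plus (scal (eps / 2) 1) (scal C (/ INR (S (S m))))).
    2:{ right. unfold plus, scal; cbn -[INR]; unfold mult; cbn -[INR]. field. lra. }
    apply norm_RInt_le with (1 := Rle_0_1) (3 := H1) (4 := H2).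
    intros t ht. specialize (HC t ht).
    assert (hk : 0 <= INR (S m) * t ^ m).
    { apply Rmult_le_pos; [lra | apply pow_le; lra]. }
    unfold norm, minus, plus, opp, scal; cbn -[INR pow]; unfold abs, mult; cbn -[INR pow].
    replace (Phi t * (INR (S m) * t ^ m) + - (Phi 1 * (INR (S m) * t ^ m)))
      with ((Phi t - Phi 1) * (INR (S m) * t ^ m)) by ring.
    rewrite Rabs_mult, (Rabs_pos_eq _ hk).
    replace (eps / 2 * (INR (S m) * t ^ m) + C * (INR (S m) * t ^ m * (1 - t)))
      with ((eps / 2 + C * (1 - t)) * (INR (S m) * t ^ m)) by ring.
    apply Rmult_le_compat_r; assumption. }
  assert (hN : INR N <= INR (S (S m))) by (apply le_INR; lia).
  assert (C / INR (S (S m)) < eps / 2).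
  { apply Rlt_div_l; [exact hm1 |].
    apply Rmult_gt_compat_l with (r := eps / 2) in HN; [| exact he].
    replace (eps / 2 * (C / (eps / 2))) with C in HN by (field; lra).
    assert (eps / 2 * INR N <= eps / 2 * INR (S (S m)))
      by (apply Rmult_le_compat_l; lra).
    lra. }
  lra.
Qed.

(** With [g t = t ^ (m + 1)] the boundary term at 0 vanishes and the one at 1 is
    [Phi 1], which is also the limit of the remaining integral. *)
Lemma moments_vanish (f : R -> R) (I : R) :
  is_RInt_gen f (at_right 0) (at_left 1) I ->
  exists M : nat -> R,
    (forall m, is_RInt_gen (fun t => f t * t ^ m) (at_right 0) (at_left 1) (M m)) /\
    M O = I /\ is_lim_seq M 0.
Proof.
  intros HI.
  destruct (primitive_of_RInt_gen 0 1 f I Rlt_0_1 HI) as [Phi [HPhi HI2]].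
  assert (hc := proj1 HPhi).
  set (W := fun m => RInt (fun t => Phi t * (INR (S m) * t ^ m)) 0 1).
  exists (fun m => match m with O => I | S m => Phi 1 - W m end).
  split; [| split]; [| reflexivity |].
  - intros [| m].
    + revert HI. apply is_RInt_gen_ext. apply filter_forall. intros z t _. cbn; ring.
    + assert (H := is_RInt_gen_primitive _ _ _ _ Rlt_0_1
        (primitive_on_mult 0 1 f Phi (fun t => t ^ S m) (fun t => INR (S m) * t ^ m)
           HPhi (is_derive_pow_S m) (continuous_power_density m))).
      cbn beta in H. rewrite RInt_point, pow1, pow_i in H by lia.
      fold (W m) in H. revert H. unfold zero; cbn -[INR pow].
      match goal with |- is_RInt_gen _ _ _ ?u -> is_RInt_gen _ _ _ ?v =>
         replace v with u by ring end.
      auto.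
  - apply is_lim_seq_incr_1.
    replace (Finite 0) with (Finite (Phi 1 - Phi 1)) by (f_equal; ring).
    apply is_lim_seq_minus'; [apply is_lim_seq_const |].
    apply is_lim_seq_power_average, hc.
Qed.

(** * Complex integrands *)

Lemma is_RInt_gen_Re (Fa Fb : (R -> Prop) -> Prop) (f : R -> C) (l : C) :
  is_RInt_gen (V := C_R_NormedModule) f Fa Fb l ->
  is_RInt_gen (fun t => Re (f t)) Fa Fb (Re l).
Proof.
  intros H P HP.
  destruct (H (fun z => P (fst z))) as [QA QB hA hB HQ].
  { destruct HP as [eps HP]. exists eps. intros z [hz _]; apply HP, hz. }
  apply (Filter_prod _ _ _ QA QB hA hB). intros x y hx hy.
  destruct (HQ x y hx hy) as [z [Hz Pz]]. exists (fst z).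
  split; [exact (is_RInt_fct_extend_fst _ _ _ _ Hz) | exact Pz].
Qed.

Lemma is_RInt_gen_Im (Fa Fb : (R -> Prop) -> Prop) (f : R -> C) (l : C) :
  is_RInt_gen (V := C_R_NormedModule) f Fa Fb l ->
  is_RInt_gen (fun t => Im (f t)) Fa Fb (Im l).
Proof.
  intros H P HP.
  destruct (H (fun z => P (snd z))) as [QA QB hA hB HQ].
  { destruct HP as [eps HP]. exists eps. intros z [_ hz]; apply HP, hz. }
  apply (Filter_prod _ _ _ QA QB hA hB). intros x y hx hy.
  destruct (HQ x y hx hy) as [z [Hz Pz]]. exists (snd z).
  split; [exact (is_RInt_fct_extend_snd _ _ _ _ Hz) | exact Pz].
Qed.

Lemma is_RInt_gen_C (Fa Fb : (R -> Prop) -> Prop) (f : R -> C) (l1 l2 : R) :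
  Filter Fa -> Filter Fb ->
  is_RInt_gen (fun t => Re (f t)) Fa Fb l1 ->
  is_RInt_gen (fun t => Im (f t)) Fa Fb l2 ->
  is_RInt_gen (V := C_R_NormedModule) f Fa Fb (l1, l2).
Proof.
  intros FA FB H1 H2. apply filterlimi_locally. intros eps.
  assert (H := filter_and _ _
    (proj1 (filterlimi_locally _ _) H1 eps) (proj1 (filterlimi_locally _ _) H2 eps)).
  revert H. apply filter_imp. intros z [[x [Hx Bx]] [y [Hy By]]].
  exists (x, y). split; [exact (is_RInt_fct_extend_pair _ _ _ _ _ Hx Hy) | split; assumption].
Qed.

Lemma complex_moments_vanish (f : R -> C) (I : C) :
  is_RInt_gen (V := C_R_NormedModule) f (at_right 0) (at_left 1) I ->
  exists M : nat -> C,
    (forall m, is_RInt_gen (V := C_R_NormedModule) (fun t => f t * RtoC (t ^ m))%C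
       (at_right 0) (at_left 1) (M m)) /\
    M O = I /\ filterlim M eventually (locally (T := C_UniformSpace) (RtoC 0)).
Proof.
  intros HI.
  destruct (moments_vanish _ _ (is_RInt_gen_Re _ _ _ _ HI)) as [M1 [H1 [I1 L1]]].
  destruct (moments_vanish _ _ (is_RInt_gen_Im _ _ _ _ HI)) as [M2 [H2 [I2 L2]]].
  exists (fun m => (M1 m, M2 m)). split; [| split].
  - intros m. apply is_RInt_gen_C; try typeclasses eauto.
    + generalize (H1 m). apply is_RInt_gen_ext. apply filter_forall.
      intros z t _. unfold Re, Im; cbn; ring.
    + generalize (H2 m). apply is_RInt_gen_ext. apply filter_forall.
      intros z t _. unfold Re, Im; cbn; ring.
  - rewrite I1, I2. symmetry; apply surjective_pairing.
  - apply filterlim_locally. intros eps.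
    assert (H := filter_and _ _
      (proj1 (filterlim_locally _ _) L1 eps) (proj1 (filterlim_locally _ _) L2 eps)).
    exact H.
Qed.

Lemma is_series_telescope (M : nat -> C) :
  filterlim M eventually (locally (T := C_UniformSpace) (RtoC 0)) ->
  is_series (V := C_NormedModule) (fun n => M n - M (S n))%C (M O).
Proof.
  intros HM.
  assert (Hsum : forall n, sum_n (G := C_AbelianGroup) (fun n => M n - M (S n))%C n
                           = (M O - M (S n))%C).
  { induction n as [| n IH].
    - apply sum_O.
    - rewrite sum_Sn, IH. unfold plus; cbn -[Cminus Cplus]. ring. }
  apply (filterlim_ext (fun n => M O - M (S n))%C); [intros n; symmetry; apply Hsum |].
  apply filterlim_locally. intros eps.
  destruct (proj1 (filterlim_locally _ _) HM eps) as [N HN].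
  exists N. intros n hn. destruct (HN (S n) ltac:(lia)) as [h1 h2].
  cbn in h1, h2. unfold AbsRing_ball, abs, minus, plus, opp in h1, h2; cbn in h1, h2.
  split; cbn; unfold AbsRing_ball, abs, minus, plus, opp; cbn.
  - rewrite <- Rabs_Ropp in h1. apply Rle_lt_trans with (2 := h1). right; f_equal; ring.
  - rewrite <- Rabs_Ropp in h2. apply Rle_lt_trans with (2 := h2). right; f_equal; ring.
Qed.

(** * The shifted beta integrals *)

Lemma Rcpower_plus_nat (t : R) (z : C) (n : nat) :
  0 < t -> Rcpower t (z + INR n)%C = (Rcpower t z * RtoC (t ^ n))%C.
Proof.
  intros ht. unfold Rcpower.
  replace (Re (z + INR n)%C) with (Re z + INR n) by reflexivity.
  replace (Im (z + INR n)%C) with (Im z) by (unfold Im; cbn; ring).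
  rewrite Rmult_plus_distr_r, exp_plus.
  change (exp (INR n * ln t)) with (Rpower t (INR n)). rewrite Rpower_pow by exact ht.
  apply injective_projections; unfold Re, Im; cbn; ring.
Qed.

Lemma ext_beta_integrand_shift (lambda sigma tau : R) (p q eta1 eta2 : C) (n : nat) (t : R) :
  0 < t < 1 ->
  ext_beta_integrand lambda sigma tau p q (eta1 + INR n)%C (eta2 + 1)%C t
  = (ext_beta_integrand lambda sigma tau p q eta1 eta2 t * RtoC (t ^ n * (1 - t)))%C.
Proof.
  intros ht. unfold ext_beta_integrand.
  replace (eta1 + INR n - 1)%C with (eta1 - 1 + INR n)%C by ring.
  replace (eta2 + 1 - 1)%C with (eta2 - 1 + INR 1)%C by (cbn [INR]; ring).
  rewrite !Rcpower_plus_nat by lra. rewrite pow_1, RtoC_mult. ring.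
Qed.

Theorem theorem5 (lambda sigma tau : R) (p q eta1 eta2 : C)
    (hlambda : 0 < lambda) (hsigma : 0 < sigma) (htau : 0 < tau)
    (hp : 0 < Re p) (hq : 0 < Re q) (heta1 : 0 < Re eta1) (heta2 : 0 < Re eta2)
    (hB : ext_beta_converges lambda sigma tau p q eta1 eta2) :
  (forall n : nat,
     ext_beta_converges lambda sigma tau p q
       (eta1 + INR n)%C (eta2 + 1)%C) /\
  is_series (V := C_NormedModule)
    (fun n : nat =>
       ext_beta lambda sigma tau p q
         (eta1 + INR n)%C (eta2 + 1)%C)
    (ext_beta lambda sigma tau p q eta1 eta2).
Proof.
  assert (HI := RInt_gen_correct (V := C_R_CompleteNormedModule) _ hB).
  destruct (complex_moments_vanish _ _ HI) as [M [HM [HM0 Mlim]]].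
  assert (Hshift : forall n, is_RInt_gen (V := C_R_NormedModule)
    (ext_beta_integrand lambda sigma tau p q (eta1 + INR n)%C (eta2 + 1)%C)
    (at_right 0) (at_left 1) (M n - M (S n))%C).
  { intros n. generalize (is_RInt_gen_minus _ _ _ _ (HM n) (HM (S n))).
    apply is_RInt_gen_ext.
    generalize (filter_prod_near_endpoints 0 1 1 0 Rlt_0_1 Rlt_0_1). apply filter_imp.
    intros [x y] [hx hy] t ht. cbn [fst snd] in *.
    assert (h1 := Rmin_glb_lt x y 0 (proj1 hx) (proj1 hy)).
    assert (h2 := Rmax_lub_lt x y 1 (proj2 hx) (proj2 hy)).
    rewrite ext_beta_integrand_shift by lra.
    assert (E : forall w : C,
      (w * RtoC (t ^ n) - w * RtoC (t ^ S n))%C = (w * RtoC (t ^ n * (1 - t)))%C).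
    { intros w. cbn [pow]. rewrite !RtoC_mult, RtoC_minus. ring. }
    apply E. }
  split.
  - intros n. exists (M n - M (S n))%C. apply Hshift.
  - replace (ext_beta lambda sigma tau p q eta1 eta2) with (M O) by exact HM0.
    apply is_series_ext with (2 := is_series_telescope M Mlim).
    intros n. symmetry. apply (is_RInt_gen_unique (V := C_R_CompleteNormedModule)), Hshift.
Qed.
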